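(* Consider shuffled binary randomized response with $\varepsilon_0(n)>0$ and $a_n:=e^{\varepsilon_0(n)}/n\to\infty$, and let $k=k(n)\in\{0,\dots,n-1\}$ be any composition sequence. Let $P_{n,k}:=T_{n,k}$ and $Q_{n,k}:=T_{n,k+1}$ be the neighboring transcript laws. Then $$\mathrm{TV}(P_{n,k},Q_{n,k})\to1.$$ Equivalently, for every fixed $\varepsilon\ge0$, the two-sided privacy curve satisfies $\delta^{(n,k)}_{\mathrm{two}}(\varepsilon)\to1$. If in addition $k/n\to\pi\in[0,1]$, then under $P_{n,k}$ one has $K_{n,k}-k\to0$ in probability, while under $Q_{n,k}$ one has $K_{n,k+1}-(k+1)\to0$ in probability.
   Context: Binary randomized response with level $\varepsilon_0(n)>0$: a user with input bit $x$ outputs $1-x$ with probability $\delta_n=1/(1+e^{\varepsilon_0(n)})$ and $x$ with probability $1-\delta_n$, independently across the $n$ users. $T_{n,k}$ is the law of the shuffled transcript (the multiset of outputs) for a dataset with exactly $k$ ones and $n-k$ zeros; it is equivalent to the law of the number $K_{n,k}$ of output ones, $K_{n,k}=k+A-B$ with $A\sim\mathrm{Bin}(n-k,\delta_n)$ and $B\sim\mathrm{Bin}(k,\delta_n)$ independent. $\mathrm{TV}(\mu,\nu):=\sup_A|\mu(A)-\nu(A)|$; $\delta_{Q\|P}(\varepsilon):=\sup_A\{Q(A)-e^{\varepsilon}P(A)\}$; $\delta^{(n,k)}_{\mathrm{two}}(\varepsilon):=\max\{\delta_{Q_{n,k}\|P_{n,k}}(\varepsilon),\delta_{P_{n,k}\|Q_{n,k}}(\varepsilon)\}$.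 *)

(* Defs.v *)
From HB Require Import structures.
From mathcomp Require Import all_boot all_order all_fingroup all_algebra.
From mathcomp Require Import finmap multiset.
From mathcomp Require Import all_classical all_reals all_analysis.

Set Implicit Arguments.
Unset Strict Implicit.
Unset Printing Implicit Defensive.

Import Order.TTheory GRing.Theory Num.Theory.
Import numFieldNormedType.Exports.

Local Open Scope classical_set_scope.
Local Open Scope ring_scope.

Definition transcript : Type := {mset bool}%mset.

HB.instance Definition _ := Choice.on transcript.
HB.instance Definition _ := isPointed.Build transcript mset0.
HB.instance Definition _ := @isMeasurable.Build default_measure_display
  transcript discrete_measurable discrete_measurable0
  discrete_measurableC discrete_measurableU.

Definition num_ones (t : transcript) : nat := (t : {mset bool}%mset) true.

Section RandomizedResponse.
Context {R : realType} (eps0 : R).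

Definition flip_prob : R := 1 / (1 + expR eps0).

Lemma flip_prob_ge0 : 0 <= flip_prob.
Proof. by rewrite divr_ge0// addr_ge0// expR_ge0. Qed.

Lemma flip_prob_le1 : flip_prob <= 1.
Proof.
by rewrite ler_pdivrMr ?mul1r ?lerDl ?expR_ge0// ltr_pwDl// expR_ge0.
Qed.

(* Probability that a user with input x outputs y. *)
Definition rr_pmf (x y : bool) : R :=
  if y == x then 1 - flip_prob else flip_prob.

Lemma rr_pmf_ge0 x y : 0 <= rr_pmf x y.
Proof.
by rewrite /rr_pmf; case: ifP => _;
  rewrite ?subr_ge0 ?flip_prob_le1 ?flip_prob_ge0.
Qed.

Lemma sum_rr_pmf x : \sum_(y : bool) rr_pmf x y = 1.
Proof. by rewrite big_bool /rr_pmf; case: x => /=; rewrite ?subrK ?subrKC. Qed.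

Section OutputLaw.
Context {n : nat} (x : n.-tuple bool).

(* Users randomize independently, so the probabilities multiply. *)
Definition rr_outputs_pmf (y : n.-tuple bool) : R :=
  \prod_(i < n) rr_pmf (tnth x i) (tnth y i).

Lemma rr_outputs_pmf_ge0 y : 0 <= rr_outputs_pmf y.
Proof. by apply: prodr_ge0 => i _; exact: rr_pmf_ge0. Qed.

Lemma sum_rr_outputs_pmf : \sum_y rr_outputs_pmf y = 1.
Proof.
pose tf (f : {ffun 'I_n -> bool}) := [tuple f i | i < n].
have tfb : bijective tf.
  exists (fun y : n.-tuple bool => [ffun i => tnth y i]).
    by move=> f; apply/ffunP => i; rewrite ffunE tnth_mktuple.
  by move=> y; apply: eq_from_tnth => i; rewrite tnth_mktuple ffunE.
rewrite (reindex tf) /=; last exact: onW_bij.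
under eq_bigr => f _.
  rewrite /rr_outputs_pmf.
  under eq_bigr => i _ do rewrite tnth_mktuple.
  over.
rewrite -(bigA_distr_bigA (fun i b => rr_pmf (tnth x i) b)) big1// => i _.
exact: sum_rr_pmf.
Qed.

Definition rr_outputs (A : set (n.-tuple bool)) : \bar R :=
  (\sum_y (rr_outputs_pmf y)%:E * \d_y A)%E.

Let rr_outputs0 : rr_outputs set0 = 0%E.
Proof. by rewrite /rr_outputs big1// => y _; rewrite measure0 mule0. Qed.

Let rr_outputs_ge0 A : (0 <= rr_outputs A)%E.
Proof.
by apply: sume_ge0 => y _; rewrite mule_ge0// lee_fin rr_outputs_pmf_ge0.
Qed.

Let rr_outputs_sigma_additive : semi_sigma_additive rr_outputs.
Proof.
move=> F mF tF mUF.
pose m y := mscale (NngNum (rr_outputs_pmf_ge0 y)) (\d_y).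
have -> : rr_outputs = (fun A => \sum_y m y A)%E by [].
rewrite [X in _ --> X](_ : _ =
    limn (fun N => \sum_(0 <= i < N) \sum_y m y (F i))%E).
  by apply: is_cvg_ereal_nneg_natsum => j _; apply: sume_ge0.
rewrite nneseries_sum//; apply: eq_bigr => y _.
exact: measure_semi_bigcup.
Qed.

HB.instance Definition _ := isMeasure.Build _ _ _ rr_outputs
  rr_outputs0 rr_outputs_ge0 rr_outputs_sigma_additive.

Let rr_outputs_setT : rr_outputs [set: _] = 1%E.
Proof.
rewrite /rr_outputs; under eq_bigr do rewrite diracT mule1.
by rewrite sumEFin sum_rr_outputs_pmf.
Qed.

HB.instance Definition _ :=
  @Measure_isProbability.Build _ _ R rr_outputs rr_outputs_setT.

End OutputLaw.

Lemma tuple_bool_measurable n (A : set (n.-tuple bool)) : measurable A.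
Proof.
rewrite -[A]image_id -bigcup_imset1.
apply: fin_bigcup_measurable; first exact: finite_finset.
move=> y _.
have -> : [set y] = \bigcap_(i in [set: 'I_n])
    ((fun z : n.-tuple bool => tnth z i) @^-1` [set tnth y i]).
  apply/seteqP; split => [z -> // | z yz].
  by apply: eq_from_tnth => i; exact: yz.
apply: fin_bigcap_measurable; first exact: finite_finset.
by move=> i _; rewrite -[X in measurable X]setTI; exact: measurable_tnth.
Qed.

Definition shuffle n (y : n.-tuple bool) : transcript := seq_mset y.

Lemma measurable_shuffle n : measurable_fun [set: n.-tuple bool] (@shuffle n).
Proof. by move=> _ A _; exact: tuple_bool_measurable. Qed.

HB.instance Definition _ n :=
  isMeasurableFun.Build _ _ _ _ (@shuffle n) (@measurable_shuffle n).

Definition shuffled_rr_of n (x : n.-tuple bool) : probability transcript R :=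
  distribution (rr_outputs x) (@shuffle n).

(* The dataset is taken with its k ones first; [shuffled_rr_ofE] below shows
   that any other dataset with k ones gives the same law. *)
Definition shuffled_rr (n k : nat) : probability transcript R :=
  shuffled_rr_of [tuple (i < k)%N | i < n].

Lemma shuffled_rr_of_perm n (x x' : n.-tuple bool) (A : set transcript) :
  perm_eq x x' -> shuffled_rr_of x A = shuffled_rr_of x' A.
Proof.
move=> /tuple_permP[p xp].
pose f (y : n.-tuple bool) := [tuple tnth y (p i) | i < n].
have fb : bijective f.
  exists (fun y : n.-tuple bool => [tuple tnth y ((p^-1)%g i) | i < n]).
    by move=> y; apply: eq_from_tnth => i; rewrite !tnth_mktuple permKV.
  by move=> y; apply: eq_from_tnth => i; rewrite !tnth_mktuple permK.
have {xp} -> : x = f x' by exact: val_inj.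
rewrite /shuffled_rr_of /distribution /pushforward /= /rr_outputs.
rewrite (reindex f) /=; last exact: onW_bij.
apply: eq_bigr => y _; congr (_%:E * _)%E.
  rewrite /rr_outputs_pmf [RHS](reindex p) /=; last exact/onW_bij/injF_bij/perm_inj.
  by apply: eq_bigr => i _; rewrite !tnth_mktuple.
have fy : shuffle (f y) = shuffle y.
  by apply/eq_seq_msetP/tuple_permP; exists p.
rewrite !diracE; congr ((_ : bool)%:R%:E).
by apply/idP/idP; rewrite !inE /preimage /= fy.
Qed.

Lemma shuffled_rr_ofE n k (x : n.-tuple bool) (A : set transcript) :
  count id x = k -> shuffled_rr_of x A = shuffled_rr n k A.
Proof.
move=> xk; apply: shuffled_rr_of_perm.
have kn : (k <= n)%N by rewrite -xk -[leqRHS](size_tuple x) count_size.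
set x0 := [tuple (i < k)%N | i < n].
have x0k : count id x0 = k.
  rewrite /= count_map -(count_map val (fun i => i < k)%N) val_enum_ord.
  by rewrite -size_filter (filter_iota_ltn 0 kn) size_iota.
have count_false (y : n.-tuple bool) : count_mem false y = (n - count id y)%N.
  have -> : count_mem false y = count (predC id) y by apply: eq_count => -[].
  by have := count_predC id y; rewrite size_tuple => /(canRL (addKn _)).
have count_true (y : n.-tuple bool) : count_mem true y = count id y.
  by apply: eq_count => -[].
apply/allP => b _; apply/eqP; rewrite -/(count_mem b x0).
by case: b; rewrite ?count_true ?count_false xk x0k.
Qed.

End RandomizedResponse.

Section Curves.
Context d (T : measurableType d) (R : realType).
Implicit Types P Q mu nu : probability T R.
Local Open Scope ereal_scope.

Definition total_variation_dist mu nu : \bar R :=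
  ereal_sup [set `|mu A - nu A| | A in measurable].

(* delta_(Q || P)(eps) *)
Definition privacy_curve Q P (eps : R) : \bar R :=
  ereal_sup [set Q A - (expR eps)%:E * P A | A in measurable].

Definition two_sided_privacy_curve P Q (eps : R) : \bar R :=
  maxe (privacy_curve Q P eps) (privacy_curve P Q eps).

(* Each X n lives on its own probability space (T, P n). *)
Definition cvg_in_probability (P : nat -> probability T R)
    (X : nat -> T -> R) (c : R) : Prop :=
  forall e : R, (0 < e)%R ->
    P n [set t | e < `|X n t - c|]%R @[n --> \oo] --> 0.

End Curves.

(* Main.v *)
(* If no user flips, the transcript reports the dataset's number of ones
   exactly; by Bernoulli's inequality this has probability
   [(1 - delta_n) ^+ n >= 1 - n delta_n >= 1 - n / e ^ eps0 n], which tends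
   to 1. So both laws concentrate on the disjoint events [K = k] and
   [K = k + 1], and testing these events gives every claim by squeezing. *)
Require Import Defs.
From HB Require Import structures.
From mathcomp Require Import all_boot all_order all_algebra.
From mathcomp Require Import finmap multiset ring lra.
From mathcomp Require Import all_classical all_reals all_analysis.

Set Implicit Arguments.
Unset Strict Implicit.
Unset Printing Implicit Defensive.

Import Order.TTheory GRing.Theory Num.Theory.
Import numFieldNormedType.Exports.

Local Open Scope classical_set_scope.
Local Open Scope ring_scope.

(** By induction: multiplying the bound for [n] by [1 - x], which is nonnegative by hypothesis,
    leaves the surplus [n x^2]. *)
Lemma bernoulli_ineq (R : realDomainType) (x : R) (n : nat) :
  x <= 1 -> 1 - n%:R * x <= (1 - x) ^+ n.
Proof.
move=> x1; elim: n => [|n IH]; first by rewrite mul0r subr0 expr0.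
rewrite exprS; apply: le_trans (ler_wpM2l _ IH); last by rewrite subr_ge0.
have -> : (1 - x) * (1 - n%:R * x) = 1 - n.+1%:R * x + n%:R * x ^+ 2.
  by rewrite -natr1; ring.
by rewrite lerDl mulr_ge0 ?sqr_ge0.
Qed.

Section ShuffledRR.
Context {R : realType} (eps : R) (n : nat).

Lemma flip_prob_le_expRN : flip_prob eps <= (expR eps)^-1.
Proof.
by rewrite /flip_prob div1r lef_pV2 ?posrE ?expR_gt0// lerDr.
Qed.

Lemma rr_outputs_pmf_refl (x : n.-tuple bool) :
  rr_outputs_pmf eps x x = (1 - flip_prob eps) ^+ n.
Proof.
rewrite /rr_outputs_pmf (eq_bigr (fun=> 1 - flip_prob eps)).
  by rewrite prodr_const card_ord.
by move=> i _; rewrite /rr_pmf eqxx.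
Qed.

Lemma num_ones_shuffle (x : n.-tuple bool) : num_ones (shuffle x) = count id x.
Proof. by rewrite /num_ones mset_seqE; apply: eq_count => -[]. Qed.

(** Among all outputs with the right count, only [y = x] is kept. Outputs whose flips cancel out
    also lie in the event, but their nonnegative mass is dropped. *)
Lemma shuffled_rr_of_num_ones (x : n.-tuple bool) :
  ((1 - n%:R / expR eps)%:E <=
   shuffled_rr_of eps x [set t | num_ones t = count id x])%E.
Proof.
apply: (@le_trans _ _ (rr_outputs_pmf eps x x)%:E).
  rewrite lee_fin rr_outputs_pmf_refl.
  apply: le_trans (bernoulli_ineq n (flip_prob_le1 eps)).
  by rewrite lerD2l lerN2 ler_wpM2l// flip_prob_le_expRN.
rewrite /shuffled_rr_of /distribution /pushforward /= /rr_outputs.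
rewrite (bigD1 x)//= diracE mem_set ?mule1; last exact: num_ones_shuffle.
rewrite leeDl// sume_ge0// => y _.
by rewrite mule_ge0// lee_fin rr_outputs_pmf_ge0.
Qed.

Lemma shuffled_rr_num_ones (k : nat) : (k <= n)%N ->
  ((1 - n%:R / expR eps)%:E <=
   shuffled_rr eps n k [set t | num_ones t = k])%E.
Proof.
move=> kn; have := shuffled_rr_of_num_ones [tuple (i < k)%N | i < n].
rewrite -/(shuffled_rr eps n k).
suff -> : count id [tuple (i < k)%N | i < n] = k by [].
rewrite /= count_map -(count_map val (fun i => i < k)%N) val_enum_ord.
by rewrite -size_filter (filter_iota_ltn 0 kn) size_iota.
Qed.

End ShuffledRR.

Section Testing.
Context d (T : measurableType d) (R : realType).
Implicit Types (P Q : probability T R) (A B : set T).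
Local Open Scope ereal_scope.

(** [A] lies in the complement of [B], whose mass is at most [c]. *)
Lemma probability_disjoint_le P A B (c : R) :
  measurable A -> measurable B -> A `&` B = set0 ->
  (1 - c)%:E <= P B -> P A <= c%:E.
Proof.
move=> mA mB AB PB; apply: (@le_trans _ _ (P (~` B))).
  apply: le_measure; rewrite ?inE//; first exact: measurableC.
  by apply/disjoints_subset.
rewrite probability_setC//; move: PB.
rewrite -(fineK (fin_num_measure P _ mB)) -EFinB !lee_fin.
by rewrite lerBlDr addrC -lerBlDr.
Qed.

Lemma privacy_curve_le1 Q P (eps : R) : privacy_curve Q P eps <= 1.
Proof.
apply: ge_ereal_sup => _ [A mA <-]; apply: (@le_trans _ _ (Q A)).
  rewrite leeBlDr ?leeDl ?mule_ge0 ?lee_fin ?expR_ge0//.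
  by rewrite fin_numM// fin_num_measure.
exact: probability_le1.
Qed.

(** [A] is the test event: [Q] gives it at least [1 - c], while [P], concentrated on the disjoint
    [B], gives it at most [c]. The loss is therefore at most [c + expR eps * c]. *)
Lemma privacy_curve_ge Q P (eps c : R) A B :
  measurable A -> measurable B -> A `&` B = set0 ->
  (1 - c)%:E <= Q A -> (1 - c)%:E <= P B ->
  (1 - (1 + expR eps) * c)%:E <= privacy_curve Q P eps.
Proof.
move=> mA mB AB QA PB.
apply: (@le_trans _ _ (Q A - (expR eps)%:E * P A)); last first.
  by apply: ereal_sup_ubound; exists A.
have -> : (1 - (1 + expR eps) * c = (1 - c) - expR eps * c)%R by ring.
rewrite EFinB; apply: leeB => //; rewrite EFinM.
apply: lee_wpmul2l; first by rewrite lee_fin expR_ge0.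
exact: probability_disjoint_le PB.
Qed.

Lemma total_variation_dist_le1 P Q : total_variation_dist P Q <= 1.
Proof.
apply: ge_ereal_sup => _ [A mA <-].
have PA1 : P A <= 1 by exact: probability_le1.
have QA1 : Q A <= 1 by exact: probability_le1.
have PA0 : 0 <= P A by [].
have QA0 : 0 <= Q A by [].
have PAfin : P A \is a fin_num by exact: fin_num_measure.
have QAfin : Q A \is a fin_num by exact: fin_num_measure.
move: PA0 PA1 QA0 QA1; rewrite -(fineK PAfin) -(fineK QAfin).
rewrite -EFinB abse_EFin !lee_fin ler_norml => *.
by apply/andP; split; lra.
Qed.

(** At level 0 the curve is the supremum of the signed differences [P A - Q A], so lower bounds on
    the curve carry over to total variation. *)
Lemma privacy_curve0_le_total_variation P Q :
  privacy_curve P Q 0 <= total_variation_dist P Q.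
Proof.
apply: ge_ereal_sup => _ [A mA <-]; rewrite expR0 mul1e.
apply: le_trans (lee_abs _) _.
by apply: ereal_sup_ubound; exists A.
Qed.

(** A deviation larger than [e > 0] excludes [N t = m n], so its probability is at most [c n]. The
    center [m n] may move with [n], hence it is subtracted and the limit is 0. *)
Lemma cvg_in_probability_natr (P : nat -> probability T R) (N : T -> nat)
    (m : nat -> nat) (c : nat -> R) :
  (forall j, measurable [set t | N t = j]) ->
  (forall (e r : R), measurable [set t | (e < `|(N t)%:R - r|)%R]) ->
  (\forall n \near \oo, (1 - c n)%:E <= P n [set t | N t = m n]) ->
  c n @[n --> \oo] --> (0 : R)%R ->
  cvg_in_probability P (fun n t => (N t)%:R - (m n)%:R)%R 0%R.
Proof.
move=> mN mE Pm c0 e e0.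
apply: (@squeeze_cvge _ _ _ _ (cst 0) _ (EFin \o c)).
- apply: filterS Pm => n Pn; rewrite measure_ge0/=.
  under eq_set do rewrite subr0.
  apply: probability_disjoint_le Pn => //.
  rewrite -subset0 => t [/= + Nt].
  by rewrite Nt subrr normr0 ltNge (ltW e0).
- exact: cvg_cst.
- by apply: cvg_EFin => //; exact: nearW.
Qed.

End Testing.

Theorem corollary6p4 (R : realType) (eps0 : nat -> R) (k : nat -> nat)
    (eps0_gt0 : forall n, (0 < n)%N -> 0 < eps0 n)
    (a_cvg : expR (eps0 n) / n%:R @[n --> \oo] --> +oo)
    (k_lt : forall n, (0 < n)%N -> (k n < n)%N) :
  let P n := shuffled_rr (eps0 n) n (k n) in
  let Q n := shuffled_rr (eps0 n) n (k n).+1 in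
  [/\ total_variation_dist (P n) (Q n) @[n --> \oo] --> 1%E,
      forall eps : R, 0 <= eps ->
        two_sided_privacy_curve (P n) (Q n) eps @[n --> \oo] --> 1%E
    & forall p : R, 0 <= p <= 1 -> (k n)%:R / n%:R @[n --> \oo] --> p ->
        cvg_in_probability P
          (fun n t => (num_ones t)%:R - (k n)%:R) 0 /\
        cvg_in_probability Q
          (fun n t => (num_ones t)%:R - (k n).+1%:R) 0].
Proof.
move=> P Q.
(* [c n] is the reciprocal of the ratio in [a_cvg]. This identity also holds at [n = 0], since
   [0^-1 = 0], but the ratio is positive only for [n > 0]. *)
pose c n : R := n%:R / expR (eps0 n).
have c0 : c n @[n --> \oo] --> (0 : R).
  have -> : c = (fun n => (expR (eps0 n) / n%:R)^-1).
    by apply/funext => n; rewrite invf_div.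
  apply/(gtr0_cvgV0 (f := fun n => expR (eps0 n) / n%:R)) => //; near=> n.
  by rewrite divr_gt0 ?expR_gt0// ltr0n; near: n; exact: nbhs_infty_gt.
have Pk : \forall n \near \oo,
    ((1 - c n)%:E <= P n [set t | num_ones t = k n])%E.
  near=> n; apply: shuffled_rr_num_ones; apply/ltnW/k_lt.
  by near: n; exact: nbhs_infty_gt.
have Qk : \forall n \near \oo,
    ((1 - c n)%:E <= Q n [set t | num_ones t = (k n).+1])%E.
  (* The strict inequality [k n < n] is the bound [(k n).+1 <= n] needed here. *)
  near=> n; apply: shuffled_rr_num_ones; apply/k_lt.
  by near: n; exact: nbhs_infty_gt.
(* One orientation suffices: it bounds the two-sided maximum from below and, at [eps = 0], total
   variation. *)
have curve_ge eps : \forall n \near \oo,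
    ((1 - (1 + expR eps) * c n)%:E <= privacy_curve (P n) (Q n) eps)%E.
  near=> n; apply: (@privacy_curve_ge _ _ _ _ _ _ _
    [set t | num_ones t = k n] [set t | num_ones t = (k n).+1]) => //.
  - by rewrite -subset0 => t [/= ->] /esym/eqP; rewrite gtn_eqF.
  - by near: n.
  - by near: n.
have lower_cvg eps : (1 - (1 + expR eps) * c n)%:E @[n --> \oo] --> 1%E.
  apply: cvg_EFin; first exact: nearW.
  rewrite -[X in _ --> X]subr0 -[X in _ - X](mulr0 (1 + expR eps)).
  by apply: cvgB; [exact: cvg_cst|exact: cvgMl_tmp].
split=> [|eps _|p _ _].
- apply: (squeeze_cvge _ (lower_cvg 0)); last exact: cvg_cst.
  apply: filterS (curve_ge 0) => n Hn; rewrite total_variation_dist_le1 andbT.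
  exact: le_trans Hn (privacy_curve0_le_total_variation _ _).
- apply: (squeeze_cvge _ (lower_cvg eps)); last exact: cvg_cst.
  apply: filterS (curve_ge eps) => n Hn.
  rewrite /two_sided_privacy_curve ge_max !privacy_curve_le1 andbT.
  by rewrite le_max Hn orbT.
- by split; [exact: cvg_in_probability_natr Pk c0
            |exact: cvg_in_probability_natr Qk c0].
Unshelve. all: by end_near.
Qed.
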